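(* Let $\Gamma$ be a group and $M$ a conical $\Gamma$-monoid with the refinement property. Let $J$ be any $\Gamma$-order ideal of $M$. Then the following are equivalent. (i) $J$ is regular. (ii) $V(J)$ is a regular closed set in $\operatorname{Spec}_\Gamma(M)$. (iii) $D(J)$ is a regular open set in $\operatorname{Spec}_\Gamma(M)$. Moreover, the map $\varphi:\operatorname{Reg}(M)\to \mathcal{RO}(\operatorname{Spec}_\Gamma(M))$, $J\mapsto D(J)$, is an order-isomorphism, and consequently $\operatorname{Reg}(M)$ is a complete Boolean algebra.
   Context: All monoids are commutative, written additively. The algebraic preorder on a monoid $M$ is: $x\le y$ iff $y=x+z$ for some $z\in M$; write $x\parallel y$ if $x\nleq y$ and $y\nleq x$. $M$ is conical if $x+y=0$ implies $x=y=0$. $M$ has the refinement property if whenever $a+b=c+d$ in $M$ there are $z_1,\dots,z_4\in M$ with $a=z_1+z_2$, $b=z_3+z_4$, $c=z_1+z_3$, $d=z_2+z_4$. A $\Gamma$-monoid is a monoid with an action of the group $\Gamma$ by monoid automorphisms. A $\Gamma$-order ideal is a submonoid that is a down-set for $\le$ and closed under the $\Gamma$-action. A proper $\Gamma$-order ideal $P$ is prime if for $\Gamma$-order ideals $J_1,J_2$, $J_1\cap J_2\subseteq P$ implies $J_1\subseteq P$ or $J_2\subseteq P$. $\operatorname{Spec}_\Gamma(M)$ is the set of prime $\Gamma$-order ideals; $V(J)=\{P\in\operatorname{Spec}_\Gamma(M):J\subseteq P\}$ and $D(J)=\operatorname{Spec}_\Gamma(M)\setminus V(J)$; its Zariski topology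 has the sets $V(J)$ ($J$ a $\Gamma$-order ideal) as closed sets. For a $\Gamma$-order ideal $J$, $J^\perp:=\{x\in M: x\parallel a\text{ for all }0\ne a\in J\}\cup\{0\}$; in a conical refinement $\Gamma$-monoid this is again a $\Gamma$-order ideal. $J^{\perp\perp}:=(J^\perp)^\perp$, and $J$ is regular if $J=J^{\perp\perp}$. $\operatorname{Reg}(M)$ is the set of regular $\Gamma$-order ideals ordered by inclusion. A subset $U$ of a topological space is regular open if $U=\operatorname{Int}(\overline U)$ and regular closed if $U=\overline{\operatorname{Int}(U)}$. $\mathcal{RO}(X)$ is the complete Boolean algebra of regular open subsets of $X$ ordered by inclusion, with $U\wedge V=U\cap V$, $U\vee V=\operatorname{Int}(\overline{U\cup V})$, $U'=\operatorname{Int}(X\setminus U)$. *)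

(* Defs.v *)
From HB Require Import structures.
From mathcomp Require Import all_boot all_order all_algebra.
From mathcomp Require Import all_classical topology.

Set Implicit Arguments.
Unset Strict Implicit.
Unset Printing Implicit Defensive.

Import Order.TTheory GRing.Theory.

Local Open Scope classical_set_scope.
Local Open Scope ring_scope.

(* Each [gact g] is an additive endomorphism with inverse [gact g^-1], hence an
   automorphism. *)
HB.mixin Record Nmodule_isGMonoid (G : groupType) M of GRing.Nmodule M := {
  gact : G -> M -> M;
  gact_nmod_morphism : forall g, nmod_morphism (gact g);
  gact1 : forall x, gact 1%g x = x;
  gactM : forall g h x, gact (g * h)%g x = gact g (gact h x);
}.

#[short(type="gMonoidType")]
HB.structure Definition GMonoid (G : groupType) :=
  {M of Nmodule_isGMonoid G M & GRing.Nmodule M}.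

Section Monoid.
Variable M : nmodType.
Implicit Types x y : M.

Definition alg_le x y := exists z, y = x + z.

Definition alg_incomp x y := ~ alg_le x y /\ ~ alg_le y x.

Definition conical := forall x y, x + y = 0 -> x = 0 /\ y = 0.

Definition refinement := forall a b c d : M, a + b = c + d ->
  exists z1 z2 z3 z4,
    [/\ a = z1 + z2, b = z3 + z4, c = z1 + z3 & d = z2 + z4].

End Monoid.

Section GIdeal.
Variables (G : groupType) (M : gMonoidType G).
Implicit Types (J P : set M) (x y : M).

Record gorder_ideal J : Prop := {
  gideal0 : J 0;
  gidealD : forall x y, J x -> J y -> J (x + y);
  gideal_le : forall x y, alg_le x y -> J y -> J x;
  gideal_act : forall (g : G) x, J x -> J (gact g x);
}.

Record gprime P : Prop := {
  gprime_ideal : gorder_ideal P;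
  gprime_proper : P <> setT;
  gprimeP : forall J1 J2, gorder_ideal J1 -> gorder_ideal J2 ->
    J1 `&` J2 `<=` P -> J1 `<=` P \/ J2 `<=` P;
}.

Definition perp J : set M :=
  [set x | forall a, J a -> a <> 0 -> alg_incomp x a] `|` [set 0].

Definition gregular J := J = perp (perp J).

Record Spec := MkSpec { spec_ideal :> set M; _ : `[< gprime spec_ideal >] }.

HB.instance Definition _ := [isSub for spec_ideal].
HB.instance Definition _ := [Choice of Spec by <:].

Lemma spec_gprime (P : Spec) : gprime P.
Proof. exact/asboolP/(valP P). Qed.

Record Reg := MkReg {
  reg_ideal :> set M;
  _ : `[< gorder_ideal reg_ideal /\ gregular reg_ideal >];
}.

HB.instance Definition _ := [isSub for reg_ideal].
HB.instance Definition _ := [Choice of Reg by <:].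
HB.instance Definition _ :=
  [SubChoice_isSubPOrder of Reg by <: with set_display].

Definition zariski_V J : set Spec := [set P | J `<=` P].

Definition zariski_D J : set Spec := ~` zariski_V J.

Definition zariski_op : set_system Spec :=
  [set U | exists2 J, gorder_ideal J & U = zariski_D J].

Lemma gideal_setI J1 J2 :
  gorder_ideal J1 -> gorder_ideal J2 -> gorder_ideal (J1 `&` J2).
Proof.
move=> [z1 D1 l1 a1] [z2 D2 l2 a2]; split.
- by split.
- by move=> x y [? ?] [? ?]; split; [exact: D1|exact: D2].
- by move=> x y xy [? ?]; split; [exact: l1 xy _|exact: l2 xy _].
- by move=> g x [? ?]; split; [exact: a1|exact: a2].
Qed.

Lemma gideal_smallest (A : set M) : gorder_ideal (smallest gorder_ideal A).
Proof.
split.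
- by move=> J [[]].
- by move=> x y Ax Ay J JA; apply: gidealD JA.1 _ _ (Ax _ JA) (Ay _ JA).
- by move=> x y xy Ay J JA; apply: gideal_le JA.1 _ _ xy (Ay _ JA).
- by move=> g x Ax J JA; apply: gideal_act JA.1 _ _ (Ax _ JA).
Qed.

Let zariski_opT : zariski_op setT.
Proof.
exists setT; first by split.
rewrite /zariski_D -setC0; congr (~` _); apply/seteqP; split=> // P /= TP.
apply: gprime_proper (spec_gprime P) _; apply/seteqP; split=> //.
Qed.

Let zariski_opI : setI_closed zariski_op.
Proof.
move=> _ _ [J1 J1i ->] [J2 J2i ->].
exists (J1 `&` J2); first exact: gideal_setI.
rewrite /zariski_D -setCU; congr (~` _); apply/seteqP; split=> P /=.
  by move=> [] JP x [] *; apply: JP.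
exact: gprimeP (spec_gprime P) _ _ _ _.
Qed.

Let zariski_op_bigU (I : Type) (U : I -> set Spec) :
  (forall i, zariski_op (U i)) -> zariski_op (\bigcup_i U i).
Proof.
move=> opU; pose J i := s2val (cid2 (opU i)).
have Ji i : gorder_ideal (J i) := s2valP (cid2 (opU i)).
have UJ i : U i = zariski_D (J i) := s2valP' (cid2 (opU i)).
exists (smallest gorder_ideal (\bigcup_i J i)); first exact: gideal_smallest.
rewrite (eq_bigcupr (fun i _ => UJ i)) -setC_bigcap; congr (~` _).
apply/seteqP; split=> P /=.
  move=> JP x; apply; split; first exact: gprime_ideal (spec_gprime P).
  by move=> y [i _]; apply: JP.
move=> sJP i _ x Jx; apply: sJP => K [_]; apply.
by exists i.
Qed.

(* The D(J) are all the open sets, so the closed sets are exactly the V(J). *)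
HB.instance Definition _ := isOpenTopological.Build Spec
  zariski_opT zariski_opI zariski_op_bigU.

End GIdeal.

(* [regopen U] is [(closure U)° = U]; [regclosed U] is [closure U° = U]. *)
Section RegularOpen.
Variable X : topologicalType.

Record RO := MkRO { ro_set :> set X; _ : `[< regopen ro_set >] }.

HB.instance Definition _ := [isSub for ro_set].
HB.instance Definition _ := [Choice of RO by <:].
HB.instance Definition _ :=
  [SubChoice_isSubPOrder of RO by <: with set_display].

Implicit Types U V W : RO.

Lemma ro_regopen U : regopen U.
Proof. exact/asboolP/(valP U). Qed.

Lemma ro_open U : open U.
Proof. by rewrite -(ro_regopen U); exact: open_interior. Qed.

Lemma ro_leE U V : (U <= V)%O = `[< (U : set X) `<=` V >].
Proof. by []. Qed.

Lemma regopen0 : regopen (set0 : set X).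
Proof. by rewrite /regopen closure0 interior0. Qed.

Lemma regopenT : regopen (setT : set X).
Proof. by rewrite /regopen closureT interiorT. Qed.

Lemma interior_closure_sub (A : set X) U :
  A `<=` U -> (closure A)° `<=` U.
Proof.
by move=> AU; rewrite -[X in _ `<=` X](ro_regopen U); exact/interiorS/closureS.
Qed.

Lemma sub_interior_closure (A : set X) : open A -> A `<=` (closure A)°.
Proof. by move=> oA; rewrite -open_subsetE//; exact: subset_closure. Qed.

Lemma regopenI U V : regopen ((U : set X) `&` V).
Proof.
apply/seteqP; split; last exact/sub_interior_closure/openI/ro_open/ro_open.
rewrite subsetI; split; exact: interior_closure_sub.
Qed.

Lemma regopen_interior_closure (A : set X) : regopen (closure A)°.
Proof. exact/interior_closed_regopen/closed_closure. Qed.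

Lemma regopen_interiorC U : regopen (~` (U : set X))°.
Proof. exact/interior_closed_regopen/open_closedC/ro_open. Qed.

Definition ro_bot := MkRO (asboolT regopen0).
Definition ro_top := MkRO (asboolT regopenT).
Definition ro_meet U V := MkRO (asboolT (regopenI U V)).
Definition ro_join U V :=
  MkRO (asboolT (regopen_interior_closure ((U : set X) `|` V))).
Definition ro_compl U := MkRO (asboolT (regopen_interiorC U)).

Let ro_lexI U V W : (U <= ro_meet V W)%O = (U <= V)%O && (U <= W)%O.
Proof.
by rewrite !ro_leE -asbool_and; apply/asbool_equiv_eq; rewrite subsetI.
Qed.

Let ro_leUx U V W : (ro_join U V <= W)%O = (U <= W)%O && (V <= W)%O.
Proof.
rewrite !ro_leE -asbool_and; apply/asbool_equiv_eq; rewrite -subUset.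
split; last exact: interior_closure_sub.
by apply: subset_trans; apply/sub_interior_closure/openU; exact: ro_open.
Qed.

HB.instance Definition _ := @Order.POrder_MeetJoin_isLattice.Build
  set_display RO ro_meet ro_join ro_lexI ro_leUx.

Let ro_meetUl : @left_distributive RO RO ro_meet ro_join.
Proof.
move=> U V W; apply: le_anti; apply/andP; split; last first.
  by rewrite leUx !leI2 ?leUl ?leUr.
apply/asboolP; suff: (closure ((U : set X) `|` V))° `&` W `<=`
    (closure (((U : set X) `|` V) `&` W))° by rewrite setIUl.
rewrite -open_subsetE; last by apply: openI; [exact: open_interior|exact: ro_open].
move=> x [/interior_subset clx Wx] B Bx.
rewrite -setIA; apply: clx; apply: filterI => //.
exact/open_nbhs_nbhs/(conj (ro_open W) Wx).
Qed.

HB.instance Definition _ :=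
  Order.Lattice_Meet_isDistrLattice.Build set_display RO ro_meetUl.

Let ro_le0x U : (ro_bot <= U)%O.
Proof. by apply/asboolP => x []. Qed.

Let ro_lex1 U : (U <= ro_top)%O.
Proof. by apply/asboolP => x _. Qed.

HB.instance Definition _ := Order.hasBottom.Build set_display RO ro_le0x.
HB.instance Definition _ := Order.hasTop.Build set_display RO ro_lex1.

Let ro_joinxC U : ro_join U (ro_compl U) = ro_top.
Proof.
apply/val_inj; rewrite /= closureU interiorC.
suff -> : closure U `|` closure (~` closure U) = setT by rewrite interiorT.
rewrite -subTset -(setUv (closure (U : set X))).
exact/setUS/subset_closure.
Qed.

Let ro_meetxC U : ro_meet U (ro_compl U) = ro_bot.
Proof.
apply/val_inj/seteqP; split=> //= x [Ux /interior_subset]; exact.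
Qed.

HB.instance Definition _ :=
  Order.TBDistrLattice_hasComplement.Build set_display RO ro_joinxC ro_meetxC.

End RegularOpen.

(* The equality says that the given order on T is the order of a Boolean
   algebra structure on T. *)
Definition complete_boolean_algebra d (T : porderType d) : Prop :=
  (exists B : ctbDistrLatticeType d, B = T :> porderType d) /\
  (forall A : set T, supremums A !=set0 /\ infimums A !=set0).

(* Main.v *)
(* In a refinement monoid the Gamma-order ideals form a distributive lattice,
   so by Zorn's lemma every Gamma-order ideal J is an intersection of primes:
   an ideal containing J and maximal among those avoiding a given x \notin J
   is prime.  Hence J |-> D(J) is an order-isomorphism from Gamma-order ideals
   to open sets.  As J^\perp is the largest ideal meeting J in 0, D(J^\perp)
   is the interior of V(J), so Int (closure (D J)) = D(J^\perp\perp), and the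
   regular ideals correspond exactly to the regular open sets. *)

From HB Require Import structures.
Require Import Defs.
From mathcomp Require Import all_boot all_order all_algebra.
From mathcomp Require Import all_classical topology.

Set Implicit Arguments.
Unset Strict Implicit.
Unset Printing Implicit Defensive.

Import Order.Theory GRing.Theory.

Local Open Scope classical_set_scope.

(** * Transport of Boolean algebra structures along order isomorphisms *)

Section TransportedBooleanAlgebra.
Variables (d d' : Order.disp_t) (T : porderType d) (B : ctbDistrLatticeType d').
Variables (f : T -> B) (g : B -> T) (fK : cancel f g) (gK : cancel g f).
Hypothesis f_mono : {mono f : x y / (x <= y)%O}.

Let g_le0x x : (g \bot <= x)%O.
Proof. by rewrite -f_mono gK le0x. Qed.

Let g_lex1 x : (x <= g \top)%O.
Proof. by rewrite -f_mono gK lex1. Qed.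

(* The dummy let makes the alias depend on the bijection, so that the instances
   below, which need it, can be attached to the alias. *)
Definition transported : Type := let _ := (fK, gK, f_mono) in T.

HB.instance Definition _ := Order.POrder.copy transported T.

HB.instance Definition _ :=
  @Order.IsoDistrLattice.Build d transported d' B f g fK gK f_mono.

HB.instance Definition _ :=
  Order.hasBottom.Build d transported g_le0x.
HB.instance Definition _ := Order.hasTop.Build d transported g_lex1.

Let transported_joinxC (x : transported) :
  (x `|` (g (~` f x) : transported))%O = \top%O.
Proof.
(* The join on [transported] unfolds to [g] of the join of the images under [f]. *)
by rewrite -[LHS]/(g (f x `|` f (g (~` f x))))%O gK joinxC.
Qed.

Let transported_meetxC (x : transported) :
  (x `&` (g (~` f x) : transported))%O = \bot%O.
Proof.
by rewrite -[LHS]/(g (f x `&` f (g (~` f x))))%O gK meetxC.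
Qed.

HB.instance Definition _ := Order.TBDistrLattice_hasComplement.Build d
  transported transported_joinxC transported_meetxC.

Definition transported_ctb : ctbDistrLatticeType d := transported.

End TransportedBooleanAlgebra.

Lemma mono_bij_boolean d d' (T : porderType d) (B : ctbDistrLatticeType d')
    (f : T -> B) : bijective f -> {mono f : x y / (x <= y)%O} ->
  exists B' : ctbDistrLatticeType d, B' = T :> porderType d.
Proof.
case=> g fK gK fm; exists (transported_ctb fK gK fm).
(* The order of [transported] is copied from [T], so once [T] and its class are destructed both
   sides are convertible. *)
case: T f g fK gK fm => S [] *; reflexivity.
Qed.

(** * The algebraic preorder and Riesz decomposition *)

Section AlgebraicOrder.
Variable M : nmodType.
Implicit Types x y : M.
Local Open Scope ring_scope.

Lemma alg_lexx x : alg_le x x.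
Proof. by exists 0; rewrite addr0. Qed.

Lemma alg_le_trans x y z : alg_le x y -> alg_le y z -> alg_le x z.
Proof. by move=> [u ->] [v ->]; exists (u + v); rewrite addrA. Qed.

Lemma alg_le_addr x y : alg_le x (x + y).
Proof. by exists y. Qed.

Lemma alg_le_addl x y : alg_le x (y + x).
Proof. by exists y; rewrite addrC. Qed.

Lemma alg_le0 x : conical M -> alg_le x 0 -> x = 0.
Proof. by move=> conM [z /esym/conM[]]. Qed.

(** Riesz decomposition: refine [a + b = x + w] and keep the two pieces of [x]. *)
Lemma refinement_le_split x a b : refinement M -> alg_le x (a + b) ->
  exists y z, [/\ x = y + z, alg_le y a & alg_le z b].
Proof.
move=> refM [w /refM[z1 [z2 [z3 [z4 [-> -> -> _]]]]]].
by exists z1, z3; split=> //; exact: alg_le_addr.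
Qed.

End AlgebraicOrder.

(** * Order ideals, primes, orthogonals and the Zariski topology *)

Section Ideals.
Variables (G : groupType) (M : gMonoidType G).
Implicit Types (J K P : set M) (x y : M).
Local Open Scope ring_scope.

Lemma gact0 (g : G) : gact g (0 : M) = 0.
Proof. by have [] := @gact_nmod_morphism G M g. Qed.

Lemma gactD (g : G) : {morph gact g : x y / x + y : M}.
Proof. by have [] := @gact_nmod_morphism G M g. Qed.

Lemma gactK (g : G) x : gact g^-1%g (gact g x) = x.
Proof. by rewrite -gactM mulVg gact1. Qed.

Lemma gactVK (g : G) x : gact g (gact g^-1%g x) = x.
Proof. by rewrite -gactM mulgV gact1. Qed.

Lemma gact_le (g : G) x y : alg_le x y -> alg_le (gact g x) (gact g y).
Proof. by move=> [z ->]; exists (gact g z); rewrite gactD. Qed.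

Lemma gideal_set0 : conical M -> gorder_ideal [set (0 : M)].
Proof.
move=> conM; split=> //.
- by move=> x y /= -> ->; rewrite addr0.
- by move=> x y /[swap] /= ->; exact: alg_le0.
- by move=> g x /= ->; rewrite gact0.
Qed.

Lemma gideal_bigcap (I : Type) (D : set I) (F : I -> set M) :
  (forall i, D i -> gorder_ideal (F i)) -> gorder_ideal (\bigcap_(i in D) F i).
Proof.
move=> Fi; split.
- by move=> i /Fi /gideal0.
- move=> x y Fx Fy i Di.
  by apply: gidealD (Fi _ Di) _ _ _ _; [exact: Fx|exact: Fy].
- by move=> x y xy Fy i Di; apply: gideal_le (Fi _ Di) _ _ xy (Fy _ Di).
- by move=> g x Fx i Di; apply: gideal_act (Fi _ Di) _ _ (Fx _ Di).
Qed.

Definition gideal_sum J K : set M :=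
  [set x | exists a b, [/\ J a, K b & x = a + b]].

(** Refinement gives the down-closure: an element below [a + b] splits into parts below [a] and
    [b]. *)
Lemma gideal_add J K : refinement M -> gorder_ideal J -> gorder_ideal K ->
  gorder_ideal (gideal_sum J K).
Proof.
move=> refM [J0 JD Jle Ja] [K0 KD Kle Ka]; split.
- by exists 0, 0; rewrite addr0.
- move=> _ _ [a [b [Ja1 Kb ->]]] [a' [b' [Ja' Kb' ->]]].
  by exists (a + a'), (b + b'); split; [exact: JD|exact: KD|rewrite addrACA].
- move=> x _ /[swap] -[a [b [Ja1 Kb ->]]].
  move=> /(refinement_le_split refM)[y [z [-> ya zb]]].
  by exists y, z; split=> //; [exact: Jle ya _|exact: Kle zb _].
- move=> g _ [a [b [Ja1 Kb ->]]].
  by exists (gact g a), (gact g b); split; [exact: Ja|exact: Ka|exact: gactD].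
Qed.

Lemma exists_maximal_gideal J x : gorder_ideal J -> ~ J x ->
  exists P, [/\ gorder_ideal P, J `<=` P, ~ P x &
    forall K, gorder_ideal K -> P `<=` K -> ~ K x -> K `<=` P].
Proof.
move=> Ji Jx.
(* J is joined to A so that the union of the empty chain is admissible. *)
pose Q := [set A : set M | gorder_ideal (J `|` A) /\ ~ (J `|` A) x].
have [|A [[JAi JAx] Amax]] := @Zorn_bigcup _ Q.
  move=> F FQ Ftot.
  (* Any two elements of the union already lie in one admissible ideal, since the family is a chain;
     closure properties are checked there. *)
  have cup2 y z : (J `|` \bigcup_(X in F) X) y -> (J `|` \bigcup_(X in F) X) z ->
      exists A, [/\ gorder_ideal (J `|` A), (J `|` A) y, (J `|` A) z &
        J `|` A `<=` J `|` \bigcup_(X in F) X].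
    have sub A : F A -> J `|` A `<=` J `|` \bigcup_(X in F) X.
      by move=> FA; apply: setUS; exact: bigcup_sup.
    move=> [Jy|[A FA Ay]] [Jz|[B FB Bz]].
    - by exists set0; rewrite setU0; split.
    - by exists B; split; [exact: (FQ _ FB).1|left|right|exact: sub].
    - by exists A; split; [exact: (FQ _ FA).1|right|left|exact: sub].
    - have [AB|BA] := Ftot _ _ FA FB.
      + by exists B; split; [exact: (FQ _ FB).1|right; exact: AB|right|exact: sub].
      + by exists A; split; [exact: (FQ _ FA).1|right|right; exact: BA|exact: sub].
  split; last by case=> // -[A FA Ax]; apply: (FQ _ FA).2; right.
  split.
  - by left; exact: gideal0.
  - by move=> y z Uy /(cup2 _ _ Uy)[A [Ai Ay Az]]; apply; exact: gidealD.
  - move=> y z yz Uz; have [A [Ai Az _]] := cup2 _ _ Uz Uz.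
    by apply; exact: gideal_le yz Az.
  - move=> g y Uy; have [A [Ai Ay _]] := cup2 _ _ Uy Uy.
    by apply; exact: gideal_act.
exists (J `|` A); split=> //.
move=> K Ki JAK Kx; apply: contrapT => KJA.
have JK : J `|` K = K by apply/setUidPr; exact: subset_trans (subsetUl A) JAK.
apply: (Amax K); last by rewrite /Q /mkset JK.
split=> [y Ay|KA]; first by apply: JAK; right.
by apply: KJA => y Ky; right; exact: KA.
Qed.

(** If neither [J1] nor [J2] lies in [P], maximality gives [x = p1 + j1 = p2 + j2] with [p1], [p2]
    in [P]. Refining splits [j1] into a part below [p2] and a part below [j2]; the latter is in both
    [J1] and [J2], so [x] would be in [P]. *)
Lemma maximal_gideal_prime P x : refinement M -> gorder_ideal P -> ~ P x ->
  (forall K, gorder_ideal K -> P `<=` K -> ~ K x -> K `<=` P) -> gprime P.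
Proof.
move=> refM Pi Px Pmax; split=> //; first by move=> PT; apply: Px; rewrite PT.
have add_x K : gorder_ideal K -> ~ K `<=` P -> gideal_sum P K x.
  move=> Ki KP; apply: contrapT => PKx; apply: KP.
  apply: subset_trans (Pmax _ (gideal_add refM Pi Ki) _ PKx).
    by move=> y Ky; exists 0, y; rewrite add0r; split=> //; exact: gideal0.
  by move=> y Py; exists y, 0; rewrite addr0; split=> //; exact: gideal0.
move=> J1 J2 J1i J2i J12P; have [?|J1P] := pselect (J1 `<=` P); first by left.
right; apply: contrapT => J2P.
have [p1 [j1 [Pp1 Jj1 xE1]]] := add_x _ J1i J1P.
have [p2 [j2 [Pp2 Jj2 xE2]]] := add_x _ J2i J2P.
have /refM[z1 [z2 [z3 [z4 [p1E j1E p2E j2E]]]]] : p1 + j1 = p2 + j2.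
  by rewrite -xE1 -xE2.
apply: Px; rewrite xE1; apply: gidealD => //; rewrite j1E; apply: gidealD => //.
  by apply: gideal_le Pi _ _ _ Pp2; rewrite p2E; exact: alg_le_addl.
apply: J12P; split.
  by apply: gideal_le J1i _ _ _ Jj1; rewrite j1E; exact: alg_le_addl.
by apply: gideal_le J2i _ _ _ Jj2; rewrite j2E; exact: alg_le_addl.
Qed.

(** An element of [K] outside [J] would be avoided by some prime containing [J]. *)
Lemma zariski_V_subset J K : refinement M -> gorder_ideal J ->
  zariski_V J `<=` zariski_V K <-> K `<=` J.
Proof.
move=> refM Ji; split; last by move=> KJ P; exact: subset_trans.
move=> VJK x Kx; apply: contrapT => Jx.
have [P [Pi JP Px Pmax]] := exists_maximal_gideal Ji Jx.
have Pp := maximal_gideal_prime refM Pi Px Pmax.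
exact: Px (VJK (MkSpec (asboolT Pp)) JP _ Kx).
Qed.

Lemma zariski_V_inj J K : refinement M -> gorder_ideal J -> gorder_ideal K ->
  zariski_V J = zariski_V K -> J = K.
Proof.
by move=> refM Ji Ki JK; apply/seteqP; split;
  apply/(zariski_V_subset _ refM) => //; rewrite JK.
Qed.

(** Incomparability reduces to one direction: if [x] is below an element of [J], then [x] itself is
    in [J] and below [x], hence zero. *)
Lemma perpP J x : conical M -> gorder_ideal J ->
  perp J x <-> forall y, alg_le y x -> J y -> y = 0.
Proof.
move=> conM Ji; split=> [[xJ|->] y|xJ].
- move=> yx Jy; apply: contrapT => y0.
  by have [_] := xJ _ Jy y0.
- by move=> /(alg_le0 conM).
have [->|x0] := pselect (x = 0); first by right.
left=> a Ja a0; split=> [xa|ax]; last exact/a0/xJ.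
by apply: x0; apply: xJ (alg_lexx x) _; exact: gideal_le xa Ja.
Qed.

Lemma gideal_perp J : conical M -> refinement M -> gorder_ideal J ->
  gorder_ideal (perp J).
Proof.
move=> conM refM Ji; have perpE x := perpP x conM Ji.
split.
- by right.
- move=> a b /perpE aJ /perpE bJ; apply/perpE => y.
  move=> /(refinement_le_split refM)[u [v [-> ua vb]]] Juv.
  have -> : u = 0.
    by apply: aJ ua _; exact: gideal_le Ji _ _ (alg_le_addr _ _) Juv.
  have -> : v = 0.
    by apply: bJ vb _; exact: gideal_le Ji _ _ (alg_le_addl _ _) Juv.
  exact: addr0.
- move=> x y xy /perpE yJ; apply/perpE => z zx.
  by apply: yJ; exact: alg_le_trans zx xy.
(* An element of [J] below [gact g x] is moved by the inverse of [g] to an element of [J] below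
   [x]. *)
- move=> g x /perpE xJ; apply/perpE => y /(gact_le g^-1%g).
  rewrite gactK => yx Jy; rewrite -(gactVK g y) (xJ _ yx) ?gact0//.
  exact: gideal_act.
Qed.

Lemma sub_perp J K : conical M -> gorder_ideal J -> gorder_ideal K ->
  K `<=` perp J <-> J `&` K `<=` [set (0 : M)].
Proof.
move=> conM Ji Ki; split=> [KJ x [Jx Kx]|JK x Kx].
  by have /(perpP _ conM Ji) := KJ _ Kx; apply=> //; exact: alg_lexx.
apply/(perpP _ conM Ji) => y yx Jy; apply: JK; split=> //.
exact: gideal_le yx Kx.
Qed.

Lemma perpS J K : J `<=` K -> perp K `<=` perp J.
Proof. by move=> JK x [xK|->]; [left=> a /JK; exact: xK|right]. Qed.

Lemma sub_perp_perp J : J `<=` perp (perp J).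
Proof.
move=> x Jx; have [->|x0] := pselect (x = 0); first by right.
by left=> a [aJ|->]// a0; have [? ?] := aJ _ Jx x0; split.
Qed.

(** The double orthogonal is monotone, so that of the intersection lies in each [F i]. *)
Lemma gregular_bigcap (I : Type) (D : set I) (F : I -> set M) :
  (forall i, D i -> gregular (F i)) -> gregular (\bigcap_(i in D) F i).
Proof.
move=> Fr; apply/seteqP; split; first exact: sub_perp_perp.
move=> x xF i Di; rewrite (Fr _ Di).
by apply: perpS x xF; apply: perpS; exact: bigcap_inf.
Qed.

Lemma open_zariskiP (U : set (Spec M)) :
  open U <-> exists2 J, gorder_ideal J & U = zariski_D J.
Proof. by []. Qed.

(** An open set [zariski_D K] lies in [zariski_V J] exactly when every prime contains [J] or [K],
    that is, when [J] and [K] meet in zero. *)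
Lemma interior_zariski_V J : conical M -> refinement M -> gorder_ideal J ->
  (zariski_V J)° = zariski_D (perp J).
Proof.
move=> conM refM Ji; have pJi := gideal_perp conM refM Ji.
apply/seteqP; split; last first.
  rewrite -open_subsetE; last by apply/open_zariskiP; exists (perp J).
  move=> P /= PJ.
  have JJ0 : J `&` perp J `<=` P.
    have JJ0 : J `&` perp J `<=` [set 0] by exact/(sub_perp conM Ji pJi).
    by move=> x /JJ0 ->; apply: gideal0; exact: gprime_ideal (spec_gprime P).
  by have [//|/PJ] := gprimeP (spec_gprime P) Ji pJi JJ0.
move=> P; rewrite /interior nbhsE => -[U [/open_zariskiP[K Ki ->] PK] KJ] pJP.
apply: PK; apply: subset_trans pJP; apply/(sub_perp conM Ji Ki).
(* It suffices that every prime contains the intersection of [J] and [K], because the primes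
   intersect in zero. *)
apply/(zariski_V_subset _ refM (gideal_set0 conM)) => Q _.
move=> x [Jx Kx]; have [KQ|KQ] := pselect (K `<=` Q); first exact: KQ.
exact: KJ KQ _ Jx.
Qed.

Lemma closure_zariski_D J : conical M -> refinement M -> gorder_ideal J ->
  closure (zariski_D J) = zariski_V (perp J).
Proof.
move=> conM refM Ji; apply: setC_inj.
by rewrite -interiorC setCK interior_zariski_V.
Qed.

(** The closure of the interior is [zariski_V (perp (perp J))], and [zariski_V] is injective on
    ideals. *)
Lemma regclosed_zariski_V J : conical M -> refinement M -> gorder_ideal J ->
  regclosed (zariski_V J) <-> gregular J.
Proof.
move=> conM refM Ji; have pJi := gideal_perp conM refM Ji.
rewrite /regclosed interior_zariski_V// closure_zariski_D//.
rewrite /gregular; split=> [VJ|<-//].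
by apply/esym/(zariski_V_inj refM) => //; exact: gideal_perp.
Qed.

Lemma regopen_zariski_D J : conical M -> refinement M -> gorder_ideal J ->
  regopen (zariski_D J) <-> gregular J.
Proof.
move=> conM refM Ji; have pJi := gideal_perp conM refM Ji.
rewrite /regopen closure_zariski_D// interior_zariski_V//.
rewrite /gregular; split=> [/setC_inj VJ|<-//].
by apply/esym/(zariski_V_inj refM) => //; exact: gideal_perp.
Qed.

End Ideals.

(** * The order isomorphism with regular open sets, and completeness *)

Section RegularIdeals.
Variables (G : groupType) (M : gMonoidType G).
Hypotheses (conM : conical M) (refM : refinement M).
Implicit Types I J : Reg M.

Lemma reg_gideal J : gorder_ideal J.
Proof. by have /asboolP[] := valP J. Qed.

Lemma reg_gregular J : gregular J.
Proof. by have /asboolP[] := valP J. Qed.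

Lemma reg_leE I J : (I <= J)%O = `[< (I : set M) `<=` J >].
Proof. by []. Qed.

Lemma regopen_reg J : regopen (zariski_D J).
Proof. exact/regopen_zariski_D/reg_gregular/reg_gideal. Qed.

Definition reg_ro J : RO (Spec M) := MkRO (asboolT (regopen_reg J)).

Lemma reg_ro_mono : {mono reg_ro : I J / (I <= J)%O}.
Proof.
move=> I J; rewrite ro_leE reg_leE; apply: asbool_equiv_eq => /=.
split=> [/subsetC2/(zariski_V_subset _ refM (reg_gideal J))//|IJ].
exact/subsetC/(zariski_V_subset _ refM (reg_gideal J)).
Qed.

(** A regular open set is some [zariski_D J], and its regularity makes [J] regular; injectivity
    comes from reflecting the order. *)
Lemma reg_ro_bij : bijective reg_ro.
Proof.
have surj (U : RO (Spec M)) : exists J, reg_ro J = U.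
  have /open_zariskiP[J Ji UJ] := ro_open U.
  have Jr : gorder_ideal J /\ gregular J.
    by split=> //; apply/regopen_zariski_D => //; rewrite -UJ; exact: ro_regopen.
  by exists (MkReg (asboolT Jr)); exact: val_inj.
pose g U := sval (cid (surj U)).
have gK : cancel g reg_ro by move=> U; exact: svalP (cid (surj U)).
by exists g => // J; apply: (inc_inj reg_ro_mono); exact: gK.
Qed.

Lemma bigcap_reg_subproof (A : set (Reg M)) :
  `[< gorder_ideal (\bigcap_(J in A) (J : set M)) /\
      gregular (\bigcap_(J in A) (J : set M)) >].
Proof.
apply/asboolP; split.
  by apply: gideal_bigcap => J _; exact: reg_gideal.
by apply: gregular_bigcap => J _; exact: reg_gregular.
Qed.

Definition bigcap_reg (A : set (Reg M)) : Reg M := MkReg (bigcap_reg_subproof A).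

Lemma infimums_bigcap_reg (A : set (Reg M)) : infimums A (bigcap_reg A).
Proof.
split=> [J AJ|J JA]; rewrite reg_leE; apply/asboolP; first exact: bigcap_inf.
by apply: sub_bigcap => K /JA; rewrite reg_leE => /asboolP.
Qed.

(** The supremum is the infimum of all upper bounds. *)
Lemma supremums_reg (A : set (Reg M)) : supremums A !=set0.
Proof.
have [lb glb] := infimums_bigcap_reg (ubound A).
by exists (bigcap_reg (ubound A)); split=> // J AJ; apply: glb => K; apply.
Qed.

End RegularIdeals.

Theorem theorem4p3 (G : groupType) (M : gMonoidType G) :
  conical M -> refinement M ->
  (forall J : set M, gorder_ideal J ->
     [<-> gregular J;
          regclosed (zariski_V J);
          regopen (zariski_D J)]) /\
  (exists phi : Reg M -> RO (Spec M),
     [/\ forall J : Reg M, phi J = zariski_D J :> set (Spec M),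
         bijective phi &
         {mono phi : I J / (I <= J)%O}]) /\
  complete_boolean_algebra (Reg M).
Proof.
move=> conM refM; split; last split.
- move=> J Ji; have VJ := regclosed_zariski_V conM refM Ji.
  have DJ := regopen_zariski_D conM refM Ji.
  by tfae=> [/VJ|/VJ/DJ|/DJ].
- exists (reg_ro conM refM).
  by split=> //; [exact: reg_ro_bij|exact: reg_ro_mono].
- split; first exact: mono_bij_boolean (reg_ro_bij conM refM)
                                       (reg_ro_mono conM refM).
  move=> A; split; first exact: supremums_reg.
  by exists (bigcap_reg A); exact: infimums_bigcap_reg.
Qed.
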